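(* Every randomized algorithm for the online multiprocessor scheduling with testing problem on $m=2$ machines has expected competitive ratio at least $\frac{21+4\sqrt{51}}{30}\approx1.6522$.
   Context: Online multiprocessor scheduling with testing on $m$ identical parallel machines: jobs $J_1,\dots,J_n$ arrive one by one in this order. When $J_j$ arrives, an upper bound $u_j\ge0$ and a testing time $t_j\ge0$ are revealed; its processing time $p_j\in[0,u_j]$ is unknown. Upon arrival the algorithm must irrevocably decide whether to test $J_j$ and on which machine to process it. An untested job occupies its machine for $u_j$ time; a tested job for $t_j+p_j$ time, $p_j$ being revealed after testing. The makespan is the maximum machine load. With $\rho_j=\min\{u_j,t_j+p_j\}$, the optimal offline makespan $C^*(I)$ is the minimum over assignments of jobs to machines of the maximum over machines of the sum of $\rho_j$ of the jobs assigned to it. A randomized algorithm is a probability distribution over deterministic online algorithms; its expected competitive ratio is $\sup_I E[C(I)]/C^*(I)$ over all instances $I$. *)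

(* Defs.v *)
From HB Require Import structures.
From mathcomp Require Import all_boot all_order all_algebra.
From mathcomp Require Import all_classical all_reals all_analysis.

Set Implicit Arguments.
Unset Strict Implicit.
Unset Printing Implicit Defensive.

Import Order.TTheory GRing.Theory Num.Theory.

Local Open Scope classical_set_scope.
Local Open Scope ring_scope.

Section SchedulingWithTesting.
Variables (R : realType) (m : nat).

Record job := Job {
  upper_bound : R ;
  testing_time : R ;
  processing_time : R }.

Definition valid_job (j : job) : bool :=
  [&& 0 <= upper_bound j, 0 <= testing_time j &
      0 <= processing_time j <= upper_bound j].

(* The jobs, in their order of arrival. *)
Definition instance := seq job.

Definition valid_instance (I : instance) : bool := all valid_job I.

(* What has been revealed about an earlier job: its upper bound, its testing
   time and, exactly when the algorithm has tested it, its processing time. *)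
Definition observation := (R * R * option R)%type.

(* [A h (u, t)] is the decision taken on a job that arrives with upper bound [u]
   and testing time [t] after the jobs observed in [h] (earliest first): whether
   to test it, and its machine.  Earlier decisions of [A] need not be recorded
   in [h], as [A] is deterministic.  Neither the number of jobs to come nor the
   processing time of the arriving job is available. *)
Definition online_algorithm := seq observation -> R * R -> bool * 'I_m.

(* A schedule lists, for each job, the time it occupies its machine and that
   machine. *)
Definition schedule := seq (R * 'I_m).

Definition load (s : schedule) (i : 'I_m) : R := \sum_(x <- s | x.2 == i) x.1.

Definition makespan (s : schedule) : R := \big[Num.max/0]_(i < m) load s i.

Fixpoint run_from (A : online_algorithm) (h : seq observation) (I : instance) :
    schedule :=
  if I is j :: I' then
    let: Job u t p := j in
    let: (test, i) := A h (u, t) in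
    (if test then t + p else u, i) ::
      run_from A (rcons h (u, t, if test then Some p else None)) I'
  else [::].

Definition run (A : online_algorithm) (I : instance) : schedule :=
  run_from A [::] I.

Definition offline_time (j : job) : R :=
  Num.min (upper_bound j) (testing_time j + processing_time j).

Definition assign (I : instance) (a : (size I).-tuple 'I_m) : schedule :=
  zip (map offline_time I) a.

(* A minimum over finitely many assignments: the neutral element [+oo] is only
   reached when there is no assignment at all, i.e. m = 0 and I is nonempty. *)
Definition optimal_makespan (I : instance) : \bar R :=
  \big[Order.min/+oo%E]_(a : (size I).-tuple 'I_m) (makespan (assign a))%:E.

Section Randomized.
Variables (d : measure_display) (T : measurableType d) (P : probability T R).

(* A randomized algorithm draws the deterministic algorithm [A w] with [w]
   distributed according to [P].  There is no restriction on [A] beyond the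
   existence of the expected makespans. *)
Definition randomized_algorithm (A : T -> online_algorithm) : Prop :=
  forall I, valid_instance I ->
    measurable_fun setT (fun w => makespan (run (A w) I)).

(* If C*(I) = 0 then, by the conventions for extended reals, the ratio is [+oo]
   for a positive expected makespan, and 0 otherwise. *)
Definition expected_competitive_ratio (A : T -> online_algorithm) : \bar R :=
  ereal_sup [set ('E_P[fun w => makespan (run (A w) I)] / optimal_makespan I)%E
            | I in [set I | valid_instance I]].

End Randomized.
End SchedulingWithTesting.

(* Main.v *)
Require Import Defs.
From mathcomp Require Import all_boot all_order all_algebra.
From mathcomp Require Import all_classical all_reals all_analysis.
From mathcomp Require Import measurable_realfun ring lra.

(** Yao's principle is applied to [n] sand jobs with (u, t) = (2, 1), whose
    processing times are independent and uniform in {0, 2}, optionally followed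
    by one rock with (u, t) = (v, v / 2) and processing time uniform in {0, v},
    where v is the optimal total work of the sand.  Each job costs every
    deterministic algorithm u on average, tested or not.  The makespan of the
    sand plus that of sand and rock is at least the larger load plus the smaller
    load plus the rock, i.e. the total work of the sand plus the rock, on average
    2 n + 3 n / 2.  The optimal makespans are about v / 2 for the sand alone, and
    3 v / 4 or v with the rock; as v = 3 n / 2 on average, the ratio tends to
    56 / 33 > 1.69 (expected makespan over expected optimum, which is also a lower
    bound on the competitive ratio).  Rounding included, n = 32 is enough. *)

Section LowerBound.
Set Implicit Arguments.
Unset Strict Implicit.
Local Open Scope ring_scope.
Import Order.TTheory GRing.Theory Num.Theory.

(** * Loads, total work and offline optima on two machines *)

Section Schedules.
Variable R : realType.
Implicit Types (s : schedule R 2) (I : instance R) (A : online_algorithm R 2).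

Definition work s : R := \sum_(x <- s) x.1.

Definition other (i : 'I_2) : 'I_2 := if i == ord0 then ord_max else ord0.

Lemma load_cons (x : R * 'I_2) s i :
  load (x :: s) i = (if x.2 == i then x.1 else 0) + load s i.
Proof. by rewrite /load big_cons; case: ifP => //; rewrite add0r. Qed.

Lemma load_rcons (x : R * 'I_2) s i :
  load (rcons s x) i = load s i + (if x.2 == i then x.1 else 0).
Proof.
by rewrite /load -cats1 big_cat /= big_cons big_nil; case: ifP => _; rewrite ?addr0.
Qed.

Lemma workE s i : work s = load s i + load s (other i).
Proof.
rewrite [X in _ + X](_ : _ = \sum_(x <- s | x.2 != i) x.1); first exact: bigID.
apply: eq_bigl => -[x k] /=; rewrite /other.
by case: i => -[|[|[]]] // ?; case: k => -[|[|[]]].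
Qed.

Lemma load_le_makespan s i : load s i <= makespan s.
Proof. exact: le_bigmax. Qed.

Lemma makespan_ge0 s : 0 <= makespan s.
Proof. exact: bigmax_ge_id. Qed.

Lemma makespan_le s (b : R) :
  load s ord0 <= b -> load s ord_max <= b -> 0 <= b -> makespan s <= b.
Proof.
move=> h0 h1 b0; apply/bigmax_leP; split=> // i _.
have [->|ni] := eqVneq i ord0; first exact: h0.
by rewrite (_ : i = ord_max) //; apply: val_inj; case: i ni => -[|[|[]]].
Qed.

Lemma work_le_makespan s : work s <= makespan s *+ 2.
Proof. by rewrite (workE s ord0) mulr2n lerD // load_le_makespan. Qed.

Definition offline_work I : R := \sum_(j <- I) offline_time j.

Lemma work_assign I (a : (size I).-tuple 'I_2) :
  work (assign a) = offline_work I.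
Proof.
rewrite /work /assign /offline_work -(big_map fst xpredT id).
rewrite -/(unzip1 _) unzip1_zip ?big_map //.
by rewrite size_map size_tuple.
Qed.

(** The assignment [a] bounds the optimum from above and half the total work bounds it from below,
    so it is a positive real that can be divided by. *)
Lemma optimal_makespan_fin I (a : seq 'I_2) (b : R) :
  0 < offline_work I -> size a = size I ->
  makespan (zip (map (@offline_time R) I) a) <= b ->
  exists o : R, [/\ 0 < o, o <= b & optimal_makespan 2 I = o%:E].
Proof.
move=> I0 /eqP sa hb.
have oub : (optimal_makespan 2 I <= b%:E)%E.
  by apply: (@bigmin_inf _ _ _ _ (Tuple sa)) => //; rewrite lee_fin.
have olb : ((offline_work I / 2)%:E <= optimal_makespan 2 I)%E.
  apply/bigmin_geP; split=> [|t _]; first exact: leey.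
  rewrite lee_fin ler_pdivrMr // mulr_natr -(work_assign t).
  exact: work_le_makespan.
case oE : (optimal_makespan 2 I) => [r| |].
- exists r; split=> //; last by rewrite -lee_fin -oE.
  by rewrite oE lee_fin in olb; apply: lt_le_trans olb; rewrite divr_gt0.
- by rewrite oE leye_eq in oub.
- by rewrite oE leeNy_eq in olb.
Qed.

Lemma load_zip_nseq (l : seq R) (i : 'I_2) :
  load (zip l (nseq (size l) (ord_max : 'I_2))) i =
  if ord_max == i then \sum_(x <- l) x else 0.
Proof.
elim: l => [|x l IHl] /=; first by rewrite /load !big_nil if_same.
by rewrite load_cons IHl big_cons /=; case: ifP => _; rewrite ?addr0.
Qed.

(* Fill the first machine until a job would exceed [g]; that job is at most 2. *)
Lemma exists_assignment I (g : R) :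
  all (fun j => 0 <= offline_time j <= 2) I ->
  0 <= g <= offline_work I + 2 ->
  exists2 a : seq 'I_2, size a = size I &
    let s := zip (map (@offline_time R) I) a in
    load s ord0 <= g /\ load s ord_max <= offline_work I - g + 2.
Proof.
elim: I g => [|j I IH] g /=.
  rewrite /offline_work big_nil => _ hg; exists [::] => //=.
  by rewrite /load !big_nil; lra.
rewrite /offline_work big_cons -/(offline_work I) => /andP[hj hI] hg.
have [jg|gj] := lerP (offline_time j) g.
  have [|a sa /= [h0 h1]] := IH (g - offline_time j) hI; first by lra.
  exists (ord0 :: a); first by rewrite /= sa.
  by rewrite /= !load_cons /=; lra.
exists (nseq (size I).+1 ord_max); first by rewrite /= size_nseq.
have /= := load_zip_nseq (map (@offline_time R) (j :: I)).
rewrite size_map => loadI; rewrite /= !loadI /= big_cons big_map.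
by rewrite -/(offline_work I); lra.
Qed.

(** The last job is handled before its processing time is known: [test] and [i] are chosen ahead of
    [p], and the earlier jobs run as if it never came. *)
Lemma run_from_rcons A h I (u t : R) :
  exists test i, forall p, run_from A h (rcons I (Job u t p)) =
    rcons (run_from A h I) (if test then t + p else u, i).
Proof.
elim: I h => [|[u' t' p'] I IH] h /=.
  by case: (A h (u, t)) => test i; exists test, i.
case: (A h (u', t')) => test i.
by have [test' [i' runE]] := IH (rcons h (u', t', if test then Some p' else None));
  exists test', i' => p; rewrite runE.
Qed.

End Schedules.

(** * Sand and rock: online cost against offline cost *)

Section HardInstances.
Variable R : realType.
Implicit Types (A : online_algorithm R 2) (w : seq bool).

(** The equally likely outcomes of the sand; expectations over them are kept as unnormalised sums,
    hence the factors [2 ^+ n] below. *)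
Fixpoint words n : seq (seq bool) :=
  if n is n'.+1 then map (cons false) (words n') ++ map (cons true) (words n')
  else [:: [::]].

Lemma size_words n w : w \in words n -> size w = n.
Proof.
elim: n w => [|n IH] w /=; first by rewrite inE => /eqP->.
by rewrite mem_cat => /orP[] /mapP[w' /IH <- ->].
Qed.

Lemma big_wordsS n (F : seq bool -> R) :
  \sum_(w <- words n.+1) F w = \sum_(w <- words n) (F (false :: w) + F (true :: w)).
Proof. by rewrite /= big_cat !big_map big_split. Qed.

Lemma sum_words_cst n (c : R) : \sum_(w <- words n) c = 2 ^+ n * c.
Proof.
elim: n => [|n IH]; first by rewrite /= big_seq1 mul1r.
by rewrite big_wordsS big_split /= IH exprS; ring.
Qed.

Definition sand (b : bool) : job R := Job 2 1 (if b then 2 else 0).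

Definition sands w : instance R := map sand w.

Definition rock (v : R) (c : bool) : job R := Job v (v / 2) (if c then v else 0).

Definition sands_rock w c : instance R :=
  rcons (sands w) (rock (offline_work (sands w)) c).

Lemma offline_sand b : offline_time (sand b) = if b then 2 else 1.
Proof.
by rewrite /offline_time /=; case: b => /=; [rewrite min_l|rewrite min_r]; lra.
Qed.

Lemma offline_rock (v : R) c :
  0 <= v -> offline_time (rock v c) = if c then v else v / 2.
Proof.
by move=> v0; rewrite /offline_time /=; case: c => /=; [rewrite min_l|rewrite min_r]; lra.
Qed.

Lemma offline_work_cons (j : job R) I :
  offline_work (j :: I) = offline_time j + offline_work I.
Proof. by rewrite /offline_work big_cons. Qed.

Lemma offline_work_rcons (j : job R) I :
  offline_work (rcons I j) = offline_work I + offline_time j.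
Proof. by rewrite /offline_work -cats1 big_cat /= big_seq1. Qed.

Lemma offline_work_sands_ge0 w : 0 <= offline_work (sands w).
Proof.
elim: w => [|b w IH]; first by rewrite /offline_work big_nil.
by rewrite offline_work_cons offline_sand; case: b; lra.
Qed.

Lemma offline_work_sands_ge1 w : (0 < size w)%N -> 1 <= offline_work (sands w).
Proof.
case: w => // b w _; have := offline_work_sands_ge0 w.
by rewrite offline_work_cons offline_sand; case: b; lra.
Qed.

Lemma sum_offline_work n :
  \sum_(w <- words n) offline_work (sands w) = 2 ^+ n * (3 / 2 * n%:R).
Proof.
elim: n => [|n IH].
  by rewrite /= big_seq1 /offline_work big_nil; ring.
rewrite big_wordsS -natr1.
under eq_bigr => w _ do rewrite !offline_work_cons !offline_sand.
rewrite !big_split /= !sum_words_cst IH exprS.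
by field.
Qed.

(* Tested or not, a sand job costs 2 on average, so every online algorithm has
   the same expected total work. *)
Lemma sum_work_run n A h :
  \sum_(w <- words n) work (run_from A h (sands w)) = 2 ^+ n * (2 * n%:R).
Proof.
elim: n h => [|n IH] h.
  by rewrite /= big_seq1 /work big_nil; ring.
have workS (x : R * 'I_2) s : work (x :: s) = x.1 + work s.
  by rewrite /work big_cons.
rewrite big_wordsS -natr1 /=.
case: (A h (2, 1)) => test i.
under eq_bigr => w _ do rewrite !workS /=.
rewrite !big_split /= !sum_words_cst !IH exprS.
by case: test; ring.
Qed.

(** Both rocks go to the same machine [i], on top of the same sand, and cost [v] on average. Their
    makespans thus sum to at least twice the load of [i] plus [v], and the makespan of the sand
    alone covers the other machine. *)
Lemma makespan_sands_rock A w :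
  2 * (work (run A (sands w)) + offline_work (sands w)) <=
  makespan (run A (sands w)) *+ 2 +
  \sum_(c <- [:: false; true]) makespan (run A (sands_rock w c)).
Proof.
set v := offline_work _.
have [test [i runE]] := run_from_rcons A [::] (sands w) v (v / 2).
have rockE c : load (run A (sands w)) i +
    (if test then v / 2 + (if c then v else 0) else v) <=
    makespan (run A (sands_rock w c)).
  rewrite /run /sands_rock /rock runE.
  by apply: le_trans (load_le_makespan _ i); rewrite load_rcons eqxx.
have {rockE} := (rockE false, rockE true) => -[/= c0 c1].
rewrite big_cons big_seq1 (workE _ i).
have := load_le_makespan (run A (sands w)) (other i).
by move: c0 c1 {runE}; case: test; lra.
Qed.

Lemma sum_makespan_ge n A :
  2 ^+ n * (7 * n%:R) <=
  \sum_(w <- words n) (makespan (run A (sands w)) *+ 2 +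
    \sum_(c <- [:: false; true]) makespan (run A (sands_rock w c))).
Proof.
apply: le_trans (ler_sum _ (fun w _ => makespan_sands_rock A w)).
rewrite -mulr_sumr big_split /= sum_work_run sum_offline_work.
by rewrite le_eqVlt; apply/orP; left; apply/eqP; field.
Qed.

Lemma sand_sizes w : all (fun j => 0 <= offline_time j <= 2) (sands w).
Proof. by rewrite all_map; apply/allP => b _ /=; rewrite offline_sand; case: b; lra. Qed.

Lemma optimal_sands w : (0 < size w)%N ->
  exists o : R, [/\ 0 < o, o <= offline_work (sands w) / 2 + 1 &
    optimal_makespan 2 (sands w) = o%:E].
Proof.
move=> /offline_work_sands_ge1 w1.
(* This target equalizes the two load bounds; the extra 1 is half the longest sand job. *)
have [|a sa [a0 a1]] :=
  @exists_assignment R (sands w) (offline_work (sands w) / 2 + 1) (sand_sizes w).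
  by lra.
apply: (optimal_makespan_fin (a := a)) => //; first by lra.
by apply: makespan_le; lra.
Qed.

Lemma optimal_sands_rock w c : (0 < size w)%N ->
  exists o : R, [/\ 0 < o,
    o <= (if c then offline_work (sands w)
          else 3 / 4 * offline_work (sands w) + 1) &
    optimal_makespan 2 (sands_rock w c) = o%:E].
Proof.
move=> /offline_work_sands_ge1; set v := offline_work _ => v1.
have v0 : 0 <= v by lra.
(* The rock will join the first machine. A rock of length [v] leaves all the sand to the second one;
   a rock of length [v / 2] takes about a quarter of it along. *)
have [a sa [a0 a1]] : exists2 a : seq 'I_2, size a = size (sands w) &
    let s := zip (map (@offline_time R) (sands w)) a in
    load s ord0 <= (if c then 0 else v / 4 + 1) /\
    load s ord_max <= (if c then v else 3 / 4 * v + 1).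
  case: c.
    exists (nseq (size (sands w)) ord_max); first by rewrite size_nseq.
    have := load_zip_nseq (map (@offline_time R) (sands w)).
    rewrite size_map => loadE; rewrite /= !loadE /= big_map.
    by rewrite -/(offline_work _).
  have [|a sa [a0 a1]] := @exists_assignment R (sands w) (v / 4 + 1) (@sand_sizes w).
    by rewrite -/v; lra.
  exists a => //; move: a0 a1; rewrite /= -/v; lra.
apply: (@optimal_makespan_fin _ _ (rcons a ord0)).
- by rewrite offline_work_rcons offline_rock // -/v; case: c {a0 a1}; lra.
- by rewrite !size_rcons sa.
rewrite map_rcons zip_rcons ?sa ?size_map //.
apply: makespan_le; rewrite ?load_rcons /= ?offline_rock -/v //;
  by move: a0 a1 => /=; case: c; lra.
Qed.

Lemma valid_sands w : valid_instance (sands w).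
Proof.
rewrite /valid_instance all_map; apply/allP => b _ /=; rewrite /valid_job /=.
by apply/and3P; split; case: b; lra.
Qed.

Lemma valid_sands_rock w c : valid_instance (sands_rock w c).
Proof.
rewrite /valid_instance all_rcons -/(valid_instance _) valid_sands andbT /valid_job /=.
have v0 := offline_work_sands_ge0 w.
by apply/and3P; split; case: c; lra.
Qed.

End HardInstances.

(** * Yao's principle for a finite family of instances *)

Section RandomizedBound.
Variables (R : realType) (d : measure_display) (T : measurableType d).
Variables (P : probability T R) (A : T -> online_algorithm R 2).
Hypothesis mA : randomized_algorithm A.

Let ratio := expected_competitive_ratio P A.

Lemma expected_makespan_le I (r o b : R) :
  ratio = r%:E -> valid_instance I -> 0 < o -> o <= b ->
  optimal_makespan 2 I = o%:E ->
  ('E_P[fun w => makespan (run (A w) I)] <= (r * b)%:E)%E.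
Proof.
move=> ratioE vI o0 ob oE.
have Ege0 : (0 <= 'E_P[fun w => makespan (run (A w) I)])%E.
  by apply: expectation_ge0 => w; exact: makespan_ge0.
have : ('E_P[fun w => makespan (run (A w) I)] / o%:E <= r%:E)%E.
  by rewrite -ratioE; apply: ereal_sup_ubound; exists I => //; rewrite -oE.
rewrite inver gt_eqF // => Er.
(* The sign of [r] is what allows [o] to be replaced by the larger [b]. *)
have r0 : 0 <= r.
  rewrite -lee_fin; apply: le_trans Er.
  by rewrite mule_ge0 // lee_fin invr_ge0 ltW.
rewrite lee_pdivrMr // in Er; apply: le_trans Er _.
by rewrite -EFinM lee_fin ler_wpM2l.
Qed.

(** The bound [K] holds for each drawn algorithm, hence in expectation; the finite sum is then
    exchanged with the integral and each term is at most the ratio times [b j]. Repetitions in [js]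
    act as weights. *)
Lemma competitive_ratio_ge_average (J : eqType) (js : seq J)
    (I : J -> instance R) (b : J -> R) (K : R) :
  0 <= K -> 0 < \sum_(j <- js) b j ->
  (forall j, valid_instance (I j)) ->
  {in js, forall j, exists o : R,
    [/\ 0 < o, o <= b j & optimal_makespan 2 (I j) = o%:E]} ->
  (forall B : online_algorithm R 2,
    K <= \sum_(j <- js) makespan (run B (I j))) ->
  ((K / \sum_(j <- js) b j)%:E <= ratio)%E.
Proof.
move=> K0 b0 vI optI lbK.
have [j0 j0js] : exists j0, j0 \in js.
  case: js b0 {optI lbK} => [|j js _]; first by rewrite big_nil ltxx.
  by exists j; rewrite mem_head.
(* A single instance of the family rules out a supremum equal to [-oo]. *)
have : (0 <= ratio)%E.
  have [x [x0 _ xE]] := optI _ j0js.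
  apply: (@le_trans _ _ ('E_P[fun w => makespan (run (A w) (I j0))] / x%:E)%E).
    rewrite inver gt_eqF // mule_ge0 //; last by rewrite lee_fin invr_ge0 ltW.
    by apply: expectation_ge0 => w; exact: makespan_ge0.
  by apply: ereal_sup_ubound; exists (I j0); [exact: vI | rewrite -xE].
case ratioE : ratio => [r| |] // r0; last by rewrite leey.
have mI j : measurable_fun [set: T] (EFin \o (fun w => makespan (run (A w) (I j)))).
  by apply/measurable_EFinP; exact: mA.
rewrite lee_fin ler_pdivrMr // -lee_fin.
apply: (@le_trans _ _ (\int[P]_w (\sum_(j <- js) (makespan (run (A w) (I j)))%:E))%E).
  rewrite -[leLHS](expectation_cst P) unlock.
  apply: ge0_le_integral => //=.
  - exact: emeasurable_sum.
  - by move=> x _; rewrite sumEFin lee_fin.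
rewrite ge0_integral_sum //; last by move=> j w _; rewrite lee_fin makespan_ge0.
rewrite mulr_sumr -sumEFin big_seq [leRHS]big_seq.
apply: lee_sum => j jjs; have [x [x0 xb xE]] := optI j jjs.
have := expected_makespan_le ratioE (vI j) x0 xb xE.
by rewrite unlock.
Qed.

End RandomizedBound.

Lemma competitive_ratio_ge (R : realType) (d : measure_display)
    (T : measurableType d) (P : probability T R)
    (A : T -> online_algorithm R 2) n :
  randomized_algorithm A -> (0 < n)%N ->
  ((56 * n%:R / (33 * n%:R + 24))%:E <= expected_competitive_ratio P A)%E.
Proof.
move=> mA n0.
(* The sand alone is repeated, so that it weighs as much as the two rocks. *)
pose js := [seq (w, k) | w <- words n, k <- [:: None; None; Some false; Some true]].
pose I (j : seq bool * option bool) : instance R :=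
  if j.2 is Some c then sands_rock R j.1 c else sands R j.1.
pose b (j : seq bool * option bool) : R :=
  let v := offline_work (sands R j.1) in
  match j.2 with
  | None => v / 2 + 1
  | Some c => if c then v else 3 / 4 * v + 1
  end.
have n1 : 0 < n%:R :> R by rewrite ltr0n.
have n2 : 0 < 2 ^+ n :> R by rewrite exprn_gt0.
have sumb : \sum_(j <- js) b j = 2 ^+ n * (33 / 8 * n%:R + 3).
  rewrite big_allpairs.
  under eq_bigr => w _ do rewrite !big_cons big_nil /b /=.
  (* The four entries for [w] add up to 2 (v / 2 + 1) + (3 v / 4 + 1) + v. *)
  rewrite (eq_bigr (fun w => 11 / 4 * offline_work (sands R w) + 3)); last first.
    by move=> w _; field.
  by rewrite big_split /= -mulr_sumr sum_offline_work sum_words_cst; field.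
have -> : 56 * n%:R / (33 * n%:R + 24) =
    2 ^+ n * (7 * n%:R) / \sum_(j <- js) b j :> R.
  by rewrite sumb; field; rewrite !gt_eqF // addr_gt0 // mulr_gt0.
apply: (competitive_ratio_ge_average P mA (I := I)) => //.
- by rewrite sumb mulr_gt0 //; lra.
- by case=> w [c|]; [exact: valid_sands_rock | exact: valid_sands].
- move=> _ /allpairsP[[w k] /= [/size_words wn _ ->]].
  by case: k => [c|]; [apply: optimal_sands_rock | apply: optimal_sands]; rewrite wn.
move=> B; rewrite big_allpairs.
apply: le_trans (sum_makespan_ge n B) _.
apply: ler_sum => w _; rewrite !big_cons !big_nil /=.
lra.
Qed.

Lemma sqrt51_bound (R : realType) :
  (21 + 4 * Num.sqrt 51) / 30 <= 56 * 32%:R / (33 * 32%:R + 24) :> R.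
Proof.
(* The square of 50 / 7 is 2500 / 49, just above 51. *)
have h : Num.sqrt 51 <= 50 / 7 :> R.
  rewrite -[leRHS]ger0_norm; last by lra.
  by rewrite -sqrtr_sqr ler_wsqrtr //; lra.
by rewrite ler_pdivlMr; lra.
Qed.

End LowerBound.

Theorem theorem5 (R : realType) (d : measure_display) (T : measurableType d)
    (P : probability T R) (A : T -> online_algorithm R 2) :
  randomized_algorithm A ->
  (((21 + 4 * Num.sqrt 51) / 30)%R%:E <= expected_competitive_ratio P A)%E.
Proof.
move=> mA; apply: Order.POrderTheory.le_trans (@competitive_ratio_ge _ _ _ P A 32 mA isT).
by rewrite lee_fin sqrt51_bound.
Qed.
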